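(* Let $n=2k$ with $k\ge 6$ an integer. Then there exist $E,F\subseteq\mathbb{Z}_n$ which are not translates of each other but have the same $3$-deck.
   Context: For $f:\mathbb{Z}_n\to\mathbb{R}$, the $3$-deck is $N_{f,3}(x_1,x_2)=\sum_{x\in\mathbb{Z}_n} f(x)f(x+x_1)f(x+x_2)$ for $x_1,x_2\in\mathbb{Z}_n$; the $3$-deck of $E\subseteq\mathbb{Z}_n$ is that of its indicator function. $E$ and $F$ are translates of each other if $F=E+t$ for some $t\in\mathbb{Z}_n$. *)

(* Defs.v *)
From mathcomp Require Import all_boot all_order all_algebra.
From mathcomp Require Import reals.

Set Implicit Arguments.
Unset Strict Implicit.
Unset Printing Implicit Defensive.

Import GRing.Theory.
Local Open Scope ring_scope.

(* For n <= 1 the type 'Z_n is Z/2Z, so these notions are about Z/nZ only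
   when 1 < n. *)

Definition deck3 (R : realType) (n : nat) (f : 'Z_n -> R) (x1 x2 : 'Z_n) : R :=
  \sum_(x : 'Z_n) f x * f (x + x1) * f (x + x2).

Definition indicator (R : realType) (n : nat) (E : {set 'Z_n}) (x : 'Z_n) : R :=
  if x \in E then 1 else 0.

Definition set_deck3 (R : realType) (n : nat) (E : {set 'Z_n}) :
    'Z_n -> 'Z_n -> R :=
  deck3 (indicator R E).

Definition translates (n : nat) (E F : {set 'Z_n}) : Prop :=
  exists t : 'Z_n, F = [set x + t | x in E].

(* Main.v *)
Require Import Defs.
From mathcomp Require Import all_boot all_order all_algebra.
From mathcomp Require Import reals.
From mathcomp Require Import zify ring.

Set Implicit Arguments.
Unset Strict Implicit.
Unset Printing Implicit Defensive.

Import GRing.Theory Num.Theory.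

(** If the complement of E is E + k, replacing the indicator f by 1 - f amounts
    to a translation, which leaves the 3-deck unchanged. Expanding
    (1 - f)(1 - f)(1 - f) then expresses twice the 3-deck of E through |E| and
    the autocorrelation of f, which is even; hence E and -E have the same
    3-deck. It remains to choose such an E that is not a translate of -E: the
    cyclic run lengths 1, 2, k - 3, 1, 2, k - 3 are not invariant under
    reflection since 1, 2, k - 3 are distinct. *)

Section SelfComplementary.

Local Open Scope ring_scope.

Variables (R : realType) (n : nat).
Implicit Types (f : 'Z_n -> R) (a c x : 'Z_n).

Lemma sum_shift f a : \sum_x f (x + a) = \sum_x f x.
Proof. by rewrite [RHS](reindex_inj (addIr a)). Qed.

Definition autocorr f a : R := \sum_x f x * f (x + a).

Lemma autocorrN f a : autocorr f (- a) = autocorr f a.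
Proof.
rewrite /autocorr -(sum_shift _ a); apply: eq_bigr => x _.
by rewrite addrK mulrC.
Qed.

Lemma deck3_self_complementary f c (fc : forall x, f (x + c) = 1 - f x) x1 x2 :
  deck3 f x1 x2 *+ 2 =
  \sum_(x : 'Z_n) 1 - (\sum_x f x) *+ 3
  + (autocorr f x1 + autocorr f x2 + autocorr f (x2 - x1)).
Proof.
have <- : \sum_x f (x + x1) * f (x + x2) = autocorr f (x2 - x1).
  rewrite /autocorr -[RHS](sum_shift _ x1); apply: eq_bigr => x _.
  by rewrite -addrA [x1 + _]addrC subrK.
have deckC : deck3 f x1 x2 =
    \sum_x (1 - f x) * (1 - f (x + x1)) * (1 - f (x + x2)).
  rewrite /deck3 -[LHS](sum_shift _ c); apply: eq_bigr => x _.
  by rewrite !(addrAC x c) !fc.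
(* Only one of the two copies is complemented, so the cubic terms cancel. Shifting two of the three
   copies of [\sum_x f x] by [x1] and [x2] leaves an identity that holds term by term. *)
rewrite mulr2n {1}deckC /deck3 /autocorr !mulrS mulr0n addr0.
rewrite -{1}(sum_shift f x1) -{1}(sum_shift f x2).
rewrite -!big_split /= -sumrB -!big_split /=; apply: eq_bigr => x _.
by ring.
Qed.

Lemma deck3_opp_self_complementary f c (fc : forall x, f (x + c) = 1 - f x)
    x1 x2 :
  deck3 (fun x => f (- x)) x1 x2 = deck3 f x1 x2.
Proof.
have -> : deck3 (fun x => f (- x)) x1 x2 = deck3 f (- x1) (- x2).
  rewrite /deck3 (reindex_inj oppr_inj); apply: eq_bigr => x _.
  by rewrite !opprD opprK.
have: deck3 f (- x1) (- x2) *+ 2 = deck3 f x1 x2 *+ 2.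
  by rewrite !(deck3_self_complementary fc) -opprD !autocorrN.
by move/(pmulrnI (isT : (0 < 2)%N)).
Qed.

End SelfComplementary.

(** Read from 0, the cyclic runs 1, 2, k - 3, 1, 2, k - 3 lie alternately inside and outside, so a
    shift by [k] swaps inside and outside. *)
Definition chiral_pattern (k m : nat) : bool :=
  [|| m == 0, 3 <= m < k, m == k.+1 | m == k.+2].

Section ChiralPattern.

Variables (k m : nat).
Hypotheses (hk : 6 <= k) (hm : m < 2 * k).

Lemma chiral_pattern_complement :
  chiral_pattern k ((m + k) %% (2 * k)) = ~~ chiral_pattern k m.
Proof.
rewrite /chiral_pattern; have [lt_mk|le_km] := ltnP m k.
  by rewrite modn_small; lia.
have -> : m + k = m - k + 2 * k by lia.
by rewrite modnDr modn_small; lia.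
Qed.

(** The inside runs have lengths 1, k - 3 >= 3 and 2, so only 0 lacks both neighbours; adding
    [(2 * k).-1] is subtracting 1 modulo [2 * k]. This marked point pins down any translation. *)
Lemma chiral_pattern_isolated :
    chiral_pattern k m -> ~~ chiral_pattern k ((m + 1) %% (2 * k)) ->
    ~~ chiral_pattern k ((m + (2 * k).-1) %% (2 * k)) ->
  m = 0.
Proof.
case: (posnP m) => // m_gt0.
have -> : m + (2 * k).-1 = m.-1 + 2 * k by lia.
rewrite modnDr [m.-1 %% _]modn_small /chiral_pattern; last by lia.
have [lt_m|le_m] := ltnP m.+1 (2 * k); last by lia.
by rewrite modn_small; lia.
Qed.

End ChiralPattern.

Theorem theorem2 (R : realType) (n k : nat) (hk : 6 <= k) (hn : n = 2 * k) :
  exists E F : {set 'Z_n},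
    ~ translates E F /\
    (forall x1 x2 : 'Z_n, set_deck3 R E x1 x2 = set_deck3 R F x1 x2).
Proof.
have n_gt1 : 1 < n by lia.
have modE : (Zp_trunc n).+2 = 2 * k by rewrite Zp_cast.
have ltZ (x : 'Z_n) : x < 2 * k by rewrite -modE.
have valD (x y : 'Z_n) : (x + y)%R = (x + y) %% (2 * k) :> nat.
  by rewrite -modE.
have val_nat i : i < 2 * k -> (i%:R : 'Z_n)%R = i :> nat.
  by move=> lt_i; rewrite val_Zp_nat // hn modn_small.
have val_opp i : 0 < i < 2 * k -> (- i%:R : 'Z_n)%R = 2 * k - i :> nat.
  move=> hi; have -> : (- i%:R : 'Z_n)%R = ((2 * k - i)%:R)%R.
    by rewrite natrB ?pchar_Zp -?hn ?pchar_Zp ?sub0r //; lia.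
  by rewrite val_nat //; lia.
pose E := [set x : 'Z_n | chiral_pattern k x].
exists E, [set x | (- x)%R \in E]; split=> [[t defF]|x1 x2]; last first.
  have fc x : indicator R E (x + k%:R)%R = (1 - indicator R E x)%R.
    rewrite /indicator !inE valD val_nat; last by lia.
    rewrite chiral_pattern_complement //.
    by case: chiral_pattern; rewrite ?subrr ?subr0.
  rewrite /set_deck3 -(deck3_opp_self_complementary fc).
  by apply: eq_bigr => x _; rewrite /indicator !inE.
have shiftE x : ((x - t)%R \in E) = ((- x)%R \in E).
  have -> : ((- x)%R \in E) = (x \in [set x | (- x)%R \in E]).
    by rewrite [RHS]inE.
  rewrite defF -{2}(subrK t x).
  by rewrite (mem_imset _ _ (addIr t)).
(* The reflection contains 0 but neither 1 nor -1; by [shiftE], [- t] is then an isolated point of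
   [E]. *)
have t0 : (- t)%R = 0%R.
  apply: val_inj; apply: (chiral_pattern_isolated hk (ltZ _)).
  - by have := shiftE 0%R; rewrite oppr0 sub0r !inE => ->.
  - have := shiftE 1%:R%R; rewrite addrC !inE valD val_nat; last by lia.
    by move=> ->; rewrite val_opp /chiral_pattern; lia.
  - have := shiftE (- 1%:R)%R; rewrite opprK addrC !inE valD val_opp; last by lia.
    by rewrite subn1 => ->; rewrite val_nat /chiral_pattern; lia.
(* Now [E] would equal its reflection, yet 3 lies in [E], while -3 is 2k - 3 >= k + 3, in the last
   outside run. *)
have := shiftE 3%:R%R; rewrite t0 addr0 !inE val_nat ?val_opp; try lia.
by rewrite /chiral_pattern; lia.
Qed.
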